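(* Consider the finite-horizon stochastic optimal control problem, the functions $f_\theta$, and the augmented problem $\tilde{\mathcal M}_\theta$ described in the context. For any $\theta\in\Theta$ and any randomized Markovian policy $\pi\in\Pi_{\mathrm{MR}}(\tilde{\mathcal M}_\theta)$, define $$\tilde V^{\pi,\theta}_t(s,x)=\mathbb E^\pi_P\Big[\sum_{h=t}^T\tilde c^\theta_h(S_h,X_h,A_h)\,\Big|\,S_t=s,X_t=x\Big].$$ Then $\tilde V^{\pi,\theta}_T(s,x)=\mathbb E_{a\sim\pi_T(\cdot|s,x)}[\tilde c^\theta_T(s,x,a)]$ for all $(s,x)\in\mathcal S_T\times\mathcal X_T$, and for all $0\le t\le T-1$ and $(s,x)\in\mathcal S_t\times\mathcal X_t$, $$\tilde V^{\pi,\theta}_t(s,x)=\mathbb E_{a\sim\pi_t(\cdot|s,x),\,\xi\sim P_t}\Big[\tilde c^\theta_t(s,x,a)+\tilde V^{\pi,\theta}_{t+1}\big(\tilde F_t(s,x,a,\xi)\big)\Big].$$ In addition, for $s\in\mathcal S_0$ let $\theta_\pi\in\operatorname{Argmin}_{\theta\in\Theta}\{\tilde V^{\pi,\theta}_0(s,0)+f_\theta(0)\}$. Then for any $\pi\in\Pi_{\mathrm{MR}}(\tilde{\mathcal M}_\theta)$, $$\mathcal R^\pi(s)=\tilde V^{\pi,\theta_\pi}_0(s,0)+f_{\theta_\pi}(0).$$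
   Context: Stochastic optimal control (SOC) problem: $T$ is a positive integer; for $0\le t\le T$, $\mathcal S_t\subseteq\mathbb R^{d_{\mathcal S}}$ is a compact state space, $\mathcal A_t\subseteq\mathbb R^{d_{\mathcal A}}$ a compact control space, $c_t:\mathcal S_t\times\mathcal A_t\to[0,1]$ a continuous cost; for $0\le t\le T-1$, $F_t:\mathcal S_t\times\mathcal A_t\times\Xi_t\to\mathcal S_{t+1}$ is a continuous transition function and the noise $\xi_t\in\Xi_t$ has distribution $P_t$, not depending on state or action; $\xi_0,\dots,\xi_{T-1}$ are independent. $S_{t+1}=F_t(S_t,A_t,\xi_t)$. $\Theta\subseteq\mathbb R^{d_\Theta}$, $f_\theta:\mathbb R\to\mathbb R$. Standing assumption: $|f_\theta(z)-f_\theta(z')|\le L_C|z-z'|$ and $|f_\theta(z)-f_{\theta'}(z)|\le L_\Theta\|\theta-\theta'\|$ for all $z,z'\in[0,T+1]$, $\theta,\theta'\in\Theta$; $\Theta$ is bounded with radius $R_\Theta$. Augmented problem $\tilde{\mathcal M}_\theta$: state space $\mathcal S_t\times\mathcal X_t$ with $\mathcal X_t=[0,t]$, action space $\mathcal A_t$, cost $\tilde c^\theta_t(s,x,a)=f_\theta(x+c_t(s,a))-f_\theta(x)$, transition function $\tilde F_t(s,x,a,\xi)=(F_t(s,a,\xi),\,x+c_t(s,a))$. $\Pi_{\mathrm{MR}}(\tilde{\mathcal M}_\theta)$ is the set of randomized Markovian policies: $\pi_t(\cdot|s,x)$ is a probability distribution on $\mathcal A_t$ for each $(s,x)\in\mathcal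 S_t\times\mathcal X_t$ (this set does not depend on $\theta$). $\mathbb E^\pi_P$ is the expectation for the augmented process under $\pi$; conditioning on $(S_t,X_t)=(s,x)$ means starting at stage $t$ from $(s,x)$. Risk: $\mathcal R^\pi(s)=\min_{\theta\in\Theta}\mathbb E^\pi_P[f_\theta(\sum_{t=0}^Tc_t(S_t,A_t))\mid S_0=s]$, where $A_t\sim\pi_t(\cdot|S_t,X_t)$, $X_0=0$, $X_{t+1}=X_t+c_t(S_t,A_t)$. *)

(* Defs.v *)
From HB Require Import structures.
From mathcomp Require Import all_boot all_order all_algebra.
From mathcomp Require Import all_classical all_reals all_analysis.

Set Implicit Arguments.
Unset Strict Implicit.
Unset Printing Implicit Defensive.

Import Order.TTheory GRing.Theory Num.Theory.
Import numFieldNormedType.Exports.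

Local Open Scope classical_set_scope.
Local Open Scope ring_scope.

Notation borel T := (g_sigma_algebraType (@open T)).
Notation aug_state R dS := (borel 'rV[R]_dS * R%type)%type.
Notation stage R dS dA :=
  (borel 'rV[R]_dS * R%type * borel 'rV[R]_dA)%type.

(* The library norm of ['rV[R]_n] is the sup norm. *)
Definition enorm (R : realType) (n : nat) (v : 'rV[R]_n) : R :=
  Num.sqrt (\sum_(i < n) v ord0 i ^+ 2).

Definition argmin (I : Type) (R : realType) (A : set I) (g : I -> \bar R) :
    set I :=
  [set i | A i /\ forall j, A j -> (g i <= g j)%E].

(* Stages are natural numbers; only the data of the stages [t <= horizon]
   (resp. [t < horizon] for the noise and the transition) is constrained or
   used.  Likewise [cost] and [transition] are functions on the ambient spaces,
   but only their restrictions to [state t `*` control t] matter.  The noise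
   spaces are arbitrary topological spaces with their Borel sigma-algebra. *)
Record soc (R : realType) (dS dA : nat) := Soc {
  horizon : nat ;
  state : nat -> set 'rV[R]_dS ;
  control : nat -> set 'rV[R]_dA ;
  noise : nat -> ptopologicalType ;
  noise_law : forall t, probability (borel (noise t)) R ;
  cost : nat -> 'rV[R]_dS -> 'rV[R]_dA -> R ;
  transition : forall t, 'rV[R]_dS -> 'rV[R]_dA -> noise t -> 'rV[R]_dS ;
  horizon_gt0 : (0 < horizon)%N ;
  state_compact : forall t, (t <= horizon)%N -> compact (state t) ;
  control_compact : forall t, (t <= horizon)%N -> compact (control t) ;
  cost_bounded : forall t s a, (t <= horizon)%N ->
    state t s -> control t a -> 0 <= cost t s a <= 1 ;
  cost_continuous : forall t, (t <= horizon)%N ->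
    {within state t `*` control t,
      continuous (fun y : 'rV[R]_dS * 'rV[R]_dA => cost t y.1 y.2)} ;
  transition_state : forall t s a (xi : noise t), (t < horizon)%N ->
    state t s -> control t a -> state t.+1 (transition s a xi) ;
  transition_continuous : forall t, (t < horizon)%N ->
    {within state t `*` control t `*` setT,
      continuous (fun y : 'rV[R]_dS * 'rV[R]_dA * noise t =>
                    transition y.1.1 y.1.2 y.2)}
}.

Arguments transition {R dS dA} _ t _ _ _.

Section augmented_problem.
Variables (R : realType) (dS dA dTheta : nat).
Implicit Types (M : soc R dS dA) (Theta : set 'rV[R]_dTheta).
Implicit Types (f : 'rV[R]_dTheta -> R -> R) (theta : 'rV[R]_dTheta).

Definition standing_assumption M Theta f (L_C L_Theta R_Theta : R) : Prop :=
  [/\ forall theta (z z' : R), Theta theta ->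
        0 <= z <= (horizon M).+1%:R -> 0 <= z' <= (horizon M).+1%:R ->
        `|f theta z - f theta z'| <= L_C * `|z - z'|,
      forall theta theta' (z : R), Theta theta -> Theta theta' ->
        0 <= z <= (horizon M).+1%:R ->
        `|f theta z - f theta' z| <= L_Theta * enorm (theta - theta')
    & forall theta, Theta theta -> enorm theta <= R_Theta].

Definition acc (t : nat) : set R := [set x | 0 <= x <= t%:R].

Definition aug_states M t : set (aug_state R dS) := state M t `*` acc t.

Definition aug_cost M f theta t (y : aug_state R dS) (a : 'rV[R]_dA) : R :=
  f theta (y.2 + cost M t y.1 a) - f theta y.2.

Definition aug_transition M t (y : aug_state R dS) (a : 'rV[R]_dA)
    (xi : noise M t) : aug_state R dS :=
  (transition M t y.1 a xi, y.2 + cost M t y.1 a).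

(* A policy is a probability kernel from the ambient augmented state space.
   Its values outside [aug_states M t] are irrelevant: as that set is closed,
   every kernel defined only on it is the restriction of such a kernel. *)
Definition policy : Type :=
  nat -> R.-pker (aug_state R dS) ~> borel 'rV[R]_dA.

Definition Pi_MR M (pi : policy) : Prop :=
  forall t y, (t <= horizon M)%N -> aug_states M t y ->
    pi t y (control M t) = 1%E.

(* A tuple [w : n.+1.-tuple (stage R dS dA)] records [((S_h, X_h), A_h)] for
   [h = t, ..., t + n], stage [h] being at index [h - t]. *)
Definition admissible M t n : set (n.+1.-tuple (stage R dS dA)) :=
  [set w | forall i : 'I_n.+1,
     aug_states M (t + i) (tnth w i).1 /\ control M (t + i) (tnth w i).2].

(* Law of the trajectory of the augmented process under [pi], started at stage
   [t] from [y] and run up to stage [t + n]:  A_t ~ pi_t(. | y), and then a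
   fresh noise xi ~ P_(t + n'), independent of the past, gives the next state,
   from which the next action is drawn.  This is the Ionescu-Tulcea formula for
   the mass of a measurable set [B].  Integrals over trajectories are over
   [admissible], which carries the law, because [transition] and [cost] are
   arbitrary elsewhere. *)
Fixpoint traj_law M (pi : policy) (t : nat) (y : aug_state R dS) (n : nat) :
    set (n.+1.-tuple (stage R dS dA)) -> \bar R :=
  match n return set (n.+1.-tuple (stage R dS dA)) -> \bar R with
  | 0 => fun B => pi t y [set a | B [tuple (y, a)]]
  | n'.+1 => fun B =>
      (\int[@traj_law M pi t y n']_(w in @admissible M t n')
        \int[noise_law M (t + n')]_xi
          let last_stage := tnth w ord_max in
          let y' := aug_transition last_stage.1 last_stage.2 xi in
          pi (t + n').+1 y' [set a | B [tuple of rcons w (y', a)]])%E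
  end.

(* Expectation of [g] for the process started at stage [t] from [y] and run
   until the horizon. *)
Definition expect M (pi : policy) (t : nat) (y : aug_state R dS)
    (g : (horizon M - t).+1.-tuple (stage R dS dA) -> R) : \bar R :=
  (\int[@traj_law M pi t y (horizon M - t)]_(w in
      @admissible M t (horizon M - t)) (g w)%:E)%E.

Definition value M f (pi : policy) theta t (y : aug_state R dS) : \bar R :=
  @expect M pi t y (fun w =>
    \sum_(i < (horizon M - t).+1)
      aug_cost M f theta (t + i) (tnth w i).1 (tnth w i).2).

(* The minimum over [Theta] as an infimum, which equals the minimum whenever
   the latter is attained. *)
Definition risk M Theta f (pi : policy) (s : 'rV[R]_dS) : \bar R :=
  ereal_inf [set @expect M pi 0 (s, 0) (fun w =>
      f theta (\sum_(i < (horizon M - 0).+1)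
                 cost M i (tnth w i).1.1 (tnth w i).2)) | theta in Theta].

End augmented_problem.

(* Main.v *)
(* Off the admissible states and controls the data are arbitrary, so the
   transition is first replaced by a measurable total one which agrees with it
   on admissible pairs.  Measurability comes from joint continuity: since the
   Euclidean factors are second countable, every open subset of the product
   with the (arbitrary) noise space is a countable union of open rectangles,
   hence lies in the product sigma-algebra.  The law of the trajectory then is
   a composition of kernels, and integrating a nonnegative function against it
   is an iterated integral that peels off the last stage.  Unfolding the
   iterated integral from the other end gives the dynamic programming equation,
   up to a constant added to the costs to make them nonnegative.  Along a
   trajectory started at [X = 0] the augmented costs telescope to
   [f (sum of the costs) - f 0], so the risk is the infimum of
   [value + f 0] over [Theta], attained at the given minimizer. *)
From HB Require Import structures.
Require Import Defs.
From mathcomp Require Import all_boot all_order all_algebra.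
From mathcomp Require Import all_classical all_reals all_analysis.
From mathcomp Require Import measurable_realfun.

Set Implicit Arguments.
Unset Strict Implicit.
Unset Printing Implicit Defensive.

Import Order.TTheory GRing.Theory Num.Theory.
Import numFieldNormedType.Exports.

Local Open Scope classical_set_scope.
Local Open Scope ring_scope.

(** * Open sets, countable bases and Borel measurability *)

Definition countable_open_base (X : topologicalType) : Prop :=
  exists B : nat -> set X, (forall n, open (B n)) /\
    forall x U, open U -> U x -> exists n, B n x /\ B n `<=` U.

(** On a product of topological spaces the Borel sigma-algebra may be larger than the product one.
    Testing on all open sets of [X] gives the stronger property, which composition with jointly
    continuous maps requires. *)
Definition open_measurable_fun d (T : measurableType d) (X : topologicalType)
    (h : T -> X) : Prop :=
  forall U : set X, open U -> measurable (h @^-1` U).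

Lemma countable_open_base_of_countType (X : topologicalType) (I : countType)
    (B : I -> set X) :
  (forall i, open (B i)) ->
  (forall x U, open U -> U x -> exists i, B i x /\ B i `<=` U) ->
  countable_open_base X.
Proof.
move=> oB baseB; exists (fun n => if unpickle n is Some i then B i else set0).
split=> [n|x U oU Ux]; first by case: unpickle => [i|]; [exact: oB|exact: open0].
by have [i Bi] := baseB x U oU Ux; exists (pickle i); rewrite pickleK.
Qed.

Lemma countable_open_base_prod (X Y : topologicalType) :
  countable_open_base X -> countable_open_base Y ->
  countable_open_base (X * Y)%type.
Proof.
move=> [B [oB baseB]] [C [oC baseC]].
apply: (@countable_open_base_of_countType _ (nat * nat)%type
  (fun i => B i.1 `*` C i.2)) => [i|[x y] U oU Uxy].
  rewrite (_ : _ `*` _ = fst @^-1` B i.1 `&` snd @^-1` C i.2)//.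
  by apply: openI; apply: open_comp => // z _; [exact: cvg_fst|exact: cvg_snd].
have : nbhs (x, y) U by apply: open_nbhs_nbhs.
case=> -[/= P Q] [Px Qy] PQU.
have [m [Bm BmP]] := baseB x _ (@open_interior _ P) Px.
have [n [Cn CnQ]] := baseC y _ (@open_interior _ Q) Qy.
exists (m, n); split=> // -[x' y'] [/= Bx' Cy']; apply: PQU.
by split; apply: interior_subset; [exact: BmP|exact: CnQ].
Qed.

(** Balls with rational centre and radius [1/(k+1)] form a base: if the centre is that close to [x]
    and [1/(k+1) < e/2], the ball stays within distance [e] of [x]. *)
Lemma countable_open_base_rV (R : realType) n : countable_open_base 'rV[R]_n.
Proof.
apply: (@countable_open_base_of_countType _ ('rV[rat]_n * nat)%type
  (fun i => ball (map_mx ratr i.1 : 'rV[R]_n) (i.2.+1%:R^-1))).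
  move=> i; exact: ball_open.
move=> x U oU Ux.
have /nbhs_ballP[e /= e0 eU] : nbhs x U by apply: open_nbhs_nbhs.
have [k ke] : exists k, (k.+1%:R^-1 : R) < e / 2.
  have := near_infty_natSinv_lt (PosNum (divr_gt0 e0 (ltr0n R 2))).
  by case=> k _ /(_ k (leqnn k)) /=; exists k.
have q_ (i : 'I_n) : exists q : rat, `|x ord0 i - ratr q| < k.+1%:R^-1.
  have := @rat_in_itvoo R (x ord0 i - k.+1%:R^-1) (x ord0 i + k.+1%:R^-1).
  case=> [|q /[!in_itv]/= /andP[q1 q2]].
    by rewrite ltrBlDr -addrA ltrDl addr_gt0// invr_gt0.
  by exists q; rewrite distrC ltr_norml; apply/andP; split;
    [rewrite ltrBrDr addrC|rewrite ltrBlDr addrC].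
pose q : 'rV[rat]_n := \row_i projT1 (cid (q_ i)).
have qx i j : `|x i j - (map_mx ratr q : 'rV[R]_n) i j| < k.+1%:R^-1.
  by rewrite !mxE ord1; exact: (projT2 (cid (q_ j))).
exists (q, k); split.
  by split=> [|i j]; rewrite ?invr_gt0// /ball/= distrC; exact: qx.
move=> y [_ qy]; apply: eU; split=> // i j; rewrite /ball /=.
rewrite (splitr e) -(subrKA (map_mx ratr q i j : R)).
rewrite (le_lt_trans (ler_normD _ _))// ltrD//; apply: lt_trans ke; first exact: qx.
exact: qy.
Qed.

(* Only one factor needs a countable base: an open set of the product is the
   union over [n] of [B n `*` V n], with [V n] the largest open set such that
   this rectangle is contained in it. *)
Lemma open_measurable_fun_pair d (T : measurableType d) (X Y : topologicalType)
    (h : T -> X) (k : T -> Y) : countable_open_base X ->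
  open_measurable_fun h -> open_measurable_fun k ->
  open_measurable_fun (fun t => (h t, k t)).
Proof.
move=> [B [oB baseB]] mh mk W oW.
pose V n := \bigcup_(V in [set V : set Y | open V /\ B n `*` V `<=` W]) V.
have -> : (fun t => (h t, k t)) @^-1` W =
    \bigcup_n ((h @^-1` B n) `&` (k @^-1` V n)).
  apply/seteqP; split=> t /=.
    move=> Wt; have : nbhs (h t, k t) W by apply: open_nbhs_nbhs.
    case=> -[/= P Q] [Px Qy] PQW.
    have [n [Bn BnP]] := baseB (h t) _ (@open_interior _ P) Px.
    exists n => //; split=> //; exists (Q°) => //; split.
      exact: open_interior.
    move=> [x y] [/= /BnP Px' Qy']; apply: PQW.
    by split; apply: interior_subset.
  by move=> [n _ [Bn [U [oU BUW] Ut]]]; apply: BUW.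
apply: bigcupT_measurable => n; apply: measurableI; first exact: mh.
by apply: mk; apply: bigcup_open => ? [].
Qed.

(** Continuity within [D] makes the preimage of [U] in [D] the trace of an ambient open set, which
    [h] pulls back to a measurable set. *)
Lemma measurable_within_continuous d (T : measurableType d)
    (X Z : topologicalType) (D : set X) (F : X -> Z) (h : T -> X) :
  measurable (h @^-1` D) -> open_measurable_fun h ->
  {within D, continuous F} ->
  forall U, open U -> measurable (h @^-1` D `&` (F \o h) @^-1` U).
Proof.
move=> mD mh /continuousP cF U /cF /open_subspaceP[V oV VU].
have -> : h @^-1` D `&` (F \o h) @^-1` U = h @^-1` V `&` h @^-1` D.
  by rewrite setIC -preimage_setI VU preimage_setI.
by apply: measurableI => //; exact: mh.
Qed.

Lemma open_measurable_fun_borel d (T : measurableType d) (X : ptopologicalType)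
    (h : T -> borel X) : measurable_fun setT h -> open_measurable_fun (h : T -> X).
Proof.
move=> mh U oU; rewrite -[_ @^-1` _]setTI; apply: mh => //.
exact: sub_sigma_algebra.
Qed.

Lemma measurable_fun_borel d (T : measurableType d) (X : ptopologicalType)
    (D : set T) (h : T -> borel X) :
  (forall U : set X, open U -> measurable (D `&` h @^-1` U)) ->
  measurable_fun D h.
Proof.
move=> mh; apply: (@measurability _ _ _ _ D h (@open X : set (set (borel X)))) => //.
by move=> _ [U oU <-]; exact: mh.
Qed.

Lemma measurable_compact_rV (R : realType) n (K : set 'rV[R]_n) :
  compact K -> measurable (K : set (borel 'rV[R]_n)).
Proof.
move=> /compact_closed => cK; rewrite -[K]setCK; apply: measurableC.
apply: sub_sigma_algebra; apply: closed_openC.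
apply: cK; exact: norm_hausdorff.
Qed.

Lemma measurable_fun_lipschitz_itv (R : realType) (f : R -> R) (k a b : R) :
  (forall x y, a <= x <= b -> a <= y <= b -> `|f x - f y| <= k * `|x - y|) ->
  measurable_fun `[a, b] f.
Proof.
move=> kf; apply: subspace_continuous_measurable_fun => //.
apply/subspace_continuousP => x /= xab.
apply/cvgrPdist_le => /= e e0; rewrite near_withinE.
(* The sign of [k] is unknown, so [|k| + 1] serves as a positive Lipschitz constant. *)
have k1 : 0 < `|k| + 1 by rewrite ltr_wpDl.
near=> y => yab.
have xy : `|x - y| < e / (`|k| + 1).
  near: y; apply/nbhs_ballP; exists (e / (`|k| + 1)) => //=.
  by rewrite divr_gt0.
rewrite (le_trans (kf _ _ _ _))//.
rewrite (@le_trans _ _ ((`|k| + 1) * `|x - y|))//.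
  by rewrite ler_wpM2r// (le_trans (ler_norm k))// lerDl.
by rewrite mulrC -ler_pdivlMr// ltW.
Unshelve. all: by end_near.
Qed.

Lemma measurable_fun_open d (T : measurableType d) (R : realType) (D : set T)
    (h : T -> R) :
  (forall U : set R, open U -> measurable (D `&` h @^-1` U)) ->
  measurable_fun D h.
Proof.
move=> mh; apply: (measurability _ (RGenOpens.measurableE R)).
by move=> _ [_ [a [b ->] <-]]; apply: mh; exact: interval_open.
Qed.

(** * Auxiliary facts on integrals and kernels *)

Section integral_bounded_add_constant.
Context d (T : measurableType d) (R : realType).
Variable mu : {measure set T -> \bar R}.

(** Boundedness on a set of mass one gives integrability, so the integral is additive, and the
    constant integrates to itself. Shifts of the costs are undone this way. *)
Lemma integral_bounded_addc (D : set T) (g : T -> R) (K c : R) :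
  measurable D -> mu D = 1%E -> measurable_fun D g ->
  (forall x, D x -> `|g x| <= K) ->
  (\int[mu]_(x in D) (g x + c)%:E = \int[mu]_(x in D) (g x)%:E + c%:E)%E.
Proof.
move=> mD muD mg gK; under eq_integral do rewrite EFinD.
rewrite integralD//=.
- by rewrite integral_cst// muD mule1.
- apply: measurable_bounded_integrable => //.
    by rewrite muD ltry.
  by exists K; split; rewrite ?num_real// => M KM x Dx; exact: le_trans (gK _ Dx) (ltW KM).
- apply: (@measurable_bounded_integrable _ _ _ _ (cst c)) => //.
    by rewrite muD ltry.
  by exists `|c|; split; rewrite ?num_real// => M KM x Dx; exact: ltW.
Qed.

End integral_bounded_add_constant.

Section kernel_precomposition.
Context d d' d3 (X : measurableType d) (Y : measurableType d')
  (Z : measurableType d3) (R : realType).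
Variables (k : R.-pker Y ~> Z) (g : X -> Y).

(** The proof [mg] is an argument so that the kernel structures attach to the term itself. *)
Definition kprecomp (mg : measurable_fun setT g) : X -> {measure set Z -> \bar R} :=
  fun x => k (g x).

Hypothesis mg : measurable_fun setT g.

Let measurable_kprecomp U : measurable U -> measurable_fun setT (kprecomp mg ^~ U).
Proof. by move=> mU; apply: (measurableT_comp (measurable_kernel k U mU) mg). Qed.

HB.instance Definition _ := isKernel.Build _ _ X Z R (kprecomp mg) measurable_kprecomp.

Let kprecomp_prob x : kprecomp mg x setT = 1%E.
Proof. exact: prob_kernel. Qed.

HB.instance Definition _ :=
  Kernel_isProbability.Build _ _ X Z R (kprecomp mg) kprecomp_prob.

End kernel_precomposition.

(** The extension of a pair by [point] is the pair of the extensions, which reduces the claim to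
    total functions. *)
Lemma measurable_fun_pairD d d1 d2 (T : measurableType d) (T1 : measurableType d1)
    (T2 : measurableType d2) (D : set T) (h : T -> T1) (k : T -> T2) :
  measurable_fun D h -> measurable_fun D k -> measurable_fun D (fun z => (h z, k z)).
Proof.
move=> mh mk mD.
have mh' := (measurable_restrictT h mD).1 mh.
have mk' := (measurable_restrictT k mD).1 mk.
have := (measurable_restrictT (fun z => (h z, k z)) mD).2.
apply => //; apply: eq_measurable_fun (measurable_fun_pair mh' mk') => z _.
by rewrite /patch; case: ifP.
Qed.

(** * Measurability of the dynamics on admissible pairs *)

Section dynamics.
Variables (R : realType) (dS dA : nat) (M : soc R dS dA).
Local Notation aug := (aug_state R dS).
Local Notation stg := (stage R dS dA).

Definition admissible_pairs t : set stg := aug_states M t `*` control M t.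

Lemma acc_measurable t : measurable (@acc R t).
Proof.
rewrite (_ : acc t = `[0, t%:R]%classic); first exact: measurable_itv.
by apply/seteqP; split=> x /=; rewrite in_itv.
Qed.

Lemma aug_states_measurable t : (t <= horizon M)%N -> measurable (aug_states M t).
Proof.
move=> tT; apply: measurableX; last exact: acc_measurable.
by apply: measurable_compact_rV; exact: state_compact.
Qed.

Lemma control_measurable t : (t <= horizon M)%N ->
  measurable (control M t : set (borel 'rV[R]_dA)).
Proof. by move=> tT; apply: measurable_compact_rV; exact: control_compact. Qed.

Lemma admissible_pairs_measurable t : (t <= horizon M)%N -> measurable (admissible_pairs t).
Proof.
by move=> tT; apply: measurableX; [exact: aug_states_measurable|exact: control_measurable].
Qed.

Lemma open_measurable_stage d (T : measurableType d) (h : T -> stg) :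
  measurable_fun setT h ->
  open_measurable_fun (fun z => ((h z).1.1, (h z).2) : 'rV[R]_dS * 'rV[R]_dA).
Proof.
move=> mh; apply: open_measurable_fun_pair; first exact: countable_open_base_rV.
- apply: open_measurable_fun_borel; apply: measurableT_comp => //.
  exact: measurableT_comp.
- by apply: open_measurable_fun_borel; exact: measurableT_comp.
Qed.

Lemma cost_measurable t : (t <= horizon M)%N ->
  measurable_fun (admissible_pairs t) (fun z => cost M t z.1.1 z.2).
Proof.
move=> tT; have mD := admissible_pairs_measurable tT.
apply: measurable_fun_open => U oU.
pose D := [set z : stg | (state M t `*` control M t) (z.1.1, z.2)].
(* Continuity is given on pairs of state and control; [admissible_pairs] also bounds the accumulated
   cost and is therefore intersected in separately. *)
rewrite (_ : _ `&` _ = admissible_pairs t `&` (D `&` (fun z : stg => cost M t z.1.1 z.2) @^-1` U)).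
  apply: measurableI => //.
  apply: (@measurable_within_continuous _ stg _ _ (state M t `*` control M t)
    (fun y : 'rV[R]_dS * 'rV[R]_dA => cost M t y.1 y.2)
    (fun z : stg => (z.1.1, z.2))) => //; last exact: cost_continuous.
    rewrite (_ : _ @^-1` _ = (state M t `*` setT) `*` control M t).
      apply: measurableX; last exact: control_measurable.
      by apply: measurableX => //; apply: measurable_compact_rV; exact: state_compact.
    by apply/seteqP; split=> -[[s x] a] /= []; [|move=> []].
  by apply: open_measurable_stage; exact: measurable_id.
by apply/seteqP; split=> -[[s x] a] /=; [move=> [[[? ?] ?] ?]|move=> [? [? ?]]].
Qed.

(** The noise is the second factor of a pair whose first factor is Euclidean, so the countable base
    is taken on the Euclidean side. *)
Lemma transition_measurable t : (t < horizon M)%N ->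
  measurable_fun (admissible_pairs t `*` setT)
    (fun y : stg * borel (noise M t) =>
       (transition M t y.1.1.1 y.1.2 y.2 : borel 'rV[R]_dS)).
Proof.
move=> tT; have mD := admissible_pairs_measurable (ltnW tT).
apply: measurable_fun_borel => U oU.
pose h := fun y : stg * borel (noise M t) =>
  (((y.1.1.1, y.1.2), y.2) : 'rV[R]_dS * 'rV[R]_dA * noise M t).
pose D := state M t `*` control M t `*` [set: noise M t].
pose F := fun y : 'rV[R]_dS * 'rV[R]_dA * noise M t => transition M t y.1.1 y.1.2 y.2.
rewrite (_ : _ `&` _ = admissible_pairs t `*` setT `&` (h @^-1` D `&` (F \o h) @^-1` U)).
  apply: measurableI; first exact: measurableX.
  apply: measurable_within_continuous => //; last exact: transition_continuous.
    rewrite (_ : _ @^-1` _ = ((state M t `*` setT) `*` control M t) `*` setT).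
      apply: measurableX => //; apply: measurableX; last exact: control_measurable (ltnW tT).
      apply: measurableX => //; apply: measurable_compact_rV.
      exact: state_compact (ltnW tT).
    by apply/seteqP; split=> -[[[s x] a] xi] /=; rewrite /D/=; tauto.
  apply: open_measurable_fun_pair.
  - by apply: countable_open_base_prod; exact: countable_open_base_rV.
  - by apply: open_measurable_stage; exact: measurable_fst.
  - by apply: open_measurable_fun_borel; exact: measurable_snd.
by apply/seteqP; split=> -[[[s x] a] xi]; rewrite /D/h/F/admissible_pairs/aug_states/=; tauto.
Qed.

Lemma aug_transition_measurable t : (t < horizon M)%N ->
  measurable_fun (admissible_pairs t `*` setT)
    (fun y : stg * borel (noise M t) => aug_transition y.1.1 y.1.2 y.2).
Proof.
move=> tT; apply: measurable_fun_pairD; first exact: transition_measurable.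
apply: measurable_funD.
  by apply: measurable_funTS; do 2 apply: measurableT_comp => //.
apply: (@measurable_comp _ _ _ _ _ _ (admissible_pairs t)
  (fun z : stg => cost M t z.1.1 z.2) _ fst).
- exact: admissible_pairs_measurable (ltnW tT).
- by move=> _ [[z xi] [/= ? _] <-].
- exact: cost_measurable (ltnW tT).
- by apply: measurable_funTS; exact: measurable_fst.
Qed.

(** With [t < horizon M] inside the set, [next_state] is measurable at every stage, being constant
    from the horizon on, so kernels can be built without side conditions. *)
Definition active_pairs t : set stg := [set z | (t < horizon M)%N /\ admissible_pairs t z].

Definition next_state t : stg * borel (noise M t) -> aug :=
  (fun y => aug_transition y.1.1 y.1.2 y.2) \_ (active_pairs t `*` setT).

Lemma next_state_measurable t : measurable_fun setT (@next_state t).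
Proof.
have [tT|Tt] := ltnP t (horizon M).
  rewrite /next_state (_ : active_pairs t = admissible_pairs t).
    apply/(measurable_restrictT _ _).1; last exact: aug_transition_measurable.
    by apply: measurableX => //; exact: admissible_pairs_measurable (ltnW tT).
  by apply/seteqP; split=> z // [].
rewrite /next_state (_ : active_pairs t = set0) ?set0X ?patch_set0//.
by apply/seteqP; split=> z // []; rewrite ltnNge Tt.
Qed.

Lemma next_stateE t z xi : (t < horizon M)%N -> admissible_pairs t z ->
  @next_state t (z, xi) = aug_transition z.1 z.2 xi.
Proof. by move=> tT tz; rewrite /next_state patchE ifT// inE. Qed.

(** Each cost is at most one, so the accumulated cost never exceeds the stage index. *)
Lemma aug_transition_states t z (xi : noise M t) : (t < horizon M)%N -> admissible_pairs t z ->
  aug_states M t.+1 (aug_transition z.1 z.2 xi).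
Proof.
move=> tT [[/= sz /andP[x0 xt]] az].
have /andP[c0 c1] := cost_bounded (ltnW tT) sz az.
split; first exact: transition_state.
by rewrite /acc/= addr_ge0//= -natr1 lerD.
Qed.

Lemma next_state_states t z xi : (t < horizon M)%N -> admissible_pairs t z ->
  aug_states M t.+1 (@next_state t (z, xi)).
Proof. by move=> tT tz; rewrite next_stateE//; exact: aug_transition_states. Qed.

End dynamics.

Local Open Scope ereal_scope.

(** * The trajectory as a composition of kernels *)

Lemma measurable_rcons d d' (T : measurableType d) (S : measurableType d') n
    (w : T -> n.-tuple S) (z : T -> S) :
  measurable_fun setT w -> measurable_fun setT z ->
  measurable_fun setT (fun x => [tuple of rcons (w x) (z x)]).
Proof.
move=> mw mz; apply/measurable_fun_tnthP => i.
have [ni|ni] := ltnP i n.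
  apply: eq_measurable_fun (measurableT_comp (@measurable_tnth _ S n (Ordinal ni)) mw).
  move=> x _ /=; rewrite !(tnth_nth (z x))/= nth_rcons size_tuple.
  by rewrite ni.
apply: eq_measurable_fun mz => x _ /=; rewrite !(tnth_nth (z x))/= nth_rcons size_tuple.
by rewrite ltnNge ni/= ifT// eqn_leq ni andbT -ltnS.
Qed.

Section trajectory_kernel.
Variables (R : realType) (dS dA : nat) (M : soc R dS dA) (pi : policy R dS dA).
Local Notation aug := (aug_state R dS).
Local Notation stg := (stage R dS dA).

Definition init_tuple (z : aug * borel 'rV[R]_dA) : 1.-tuple stg := [tuple z].

Lemma init_tuple_measurable : measurable_fun setT init_tuple.
Proof. by apply/measurable_fun_tnthP => i; rewrite ord1; exact: measurable_id. Qed.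

Section step.
Variables (k n : nat).
Local Notation X := (aug * n.+1.-tuple stg)%type.

Definition next_of (v : X * borel (noise M k)) : aug :=
  next_state (t := k) (tnth v.1.2 ord_max, v.2).

Lemma next_of_measurable : measurable_fun setT next_of.
Proof.
apply: (measurableT_comp (@next_state_measurable R dS dA M k)).
apply: measurable_fun_pair; last exact: measurable_snd.
apply: (measurableT_comp (@measurable_tnth _ stg n.+1 ord_max)).
exact: measurableT_comp.
Qed.

Definition extend (v : X * borel (noise M k) * borel 'rV[R]_dA) : n.+2.-tuple stg :=
  [tuple of rcons v.1.1.2 (next_of v.1, v.2)].

Lemma extend_measurable : measurable_fun setT extend.
Proof.
apply: measurable_rcons.
  by apply: measurableT_comp => //; exact: measurableT_comp.
apply: measurable_fun_pair; last exact: measurable_snd.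
by apply: measurableT_comp; [exact: next_of_measurable|exact: measurable_fst].
Qed.

Definition noise_kernel : X -> {measure set (borel (noise M k)) -> \bar R} :=
  kprobability (@measurable_cst _ _ X (pprobability (borel (noise M k)) R) setT
    (noise_law M k : pprobability _ R)).

HB.instance Definition _ := ProbabilityKernel.on noise_kernel.

(** Noise, then action, then a Dirac mass appending the new stage. In a composition the second
    kernel receives the source along with the intermediate draw, hence the initial state beside the
    trajectory in [X]. *)
Definition step_kernel : R.-sfker X ~> n.+2.-tuple stg :=
  noise_kernel \; (kprecomp (pi k.+1) next_of_measurable \; kdirac extend_measurable).

Lemma integral_step_kernel (v : X) (g : n.+2.-tuple stg -> \bar R) :
  (forall w, 0 <= g w) -> measurable_fun setT g ->
  \int[step_kernel v]_w g w =
  \int[noise_law M k]_xi \int[pi k.+1 (next_of (v, xi))]_a g (extend (v, xi, a)).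
Proof.
move=> g0 mg; rewrite integral_kcomp//.
apply: eq_integral => xi _; rewrite integral_kcomp//.
apply: eq_integral => a _; rewrite /kdirac integral_dirac// diracT mul1e//.
Qed.

End step.

(** Typed as s-finite, the structure carried along by composition; total mass one is recovered in
    [traj_kernel_setT]. *)
Fixpoint traj_kernel (t n : nat) : R.-sfker aug ~> n.+1.-tuple stg :=
  match n with
  | 0 => pi t \; kdirac init_tuple_measurable
  | n'.+1 => traj_kernel t n' \; step_kernel (t + n') n'
  end.

End trajectory_kernel.

(** * Integrals against set functions and on sets of full measure *)

Section set_function_integral.
Import HBNNSimple.

(** Meant for [traj_law], a bare set function. The integral is built from simple functions, whose
    level sets are measurable, so it only sees the values on measurable sets. *)
Lemma eq_integral_set_function d (T : measurableType d) (R : realType)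
    (m1 m2 : set T -> \bar R) (D : set T) (f : T -> \bar R) :
  (forall A, measurable A -> m1 A = m2 A) ->
  \int[m1]_(x in D) f x = \int[m2]_(x in D) f x.
Proof.
move=> m12; rewrite /integral.
have E g :
    [set sintegral m1 (h : T -> R) |
       h in [set h : {nnsfun T >-> R} | forall x, (h x)%:E <= g x]] =
    [set sintegral m2 (h : T -> R) |
       h in [set h : {nnsfun T >-> R} | forall x, (h x)%:E <= g x]].
  have S (h : {nnsfun T >-> R}) : sintegral m1 h = sintegral m2 h.
    by apply: eq_fsbigr => x _; rewrite m12//; exact: measurable_sfunP.
  by apply/seteqP; split=> _ [h hg <-]; exists h.
by rewrite !E.
Qed.

End set_function_integral.

Lemma full_measureC d (T : measurableType d) (R : realType)
    (mu : {measure set T -> \bar R}) (A : set T) : measurable A ->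
  mu setT = 1 -> mu A = 1 -> mu (~` A) = 0.
Proof.
move=> mA muT muA; rewrite -setTD measureD//= ?muT ?ltry//.
by rewrite setTI muA subee.
Qed.

Lemma full_measure_integral d (T : measurableType d) (R : realType)
    (mu : {measure set T -> \bar R}) (A : set T) (f : T -> \bar R) :
  measurable A -> mu setT = 1 -> mu A = 1 ->
  (forall x, 0 <= f x) -> measurable_fun setT f ->
  \int[mu]_x f x = \int[mu]_(x in A) f x.
Proof.
move=> mA muT muA f0 mf.
rewrite (ge0_negligible_integral (measurableC mA))//; last exact: full_measureC.
by rewrite setTD setCK.
Qed.

Lemma measurable_fun_integral_section d1 d2 d3 (X : measurableType d1)
    (Y : measurableType d2) (Z : measurableType d3) (R : realType)
    (k : R.-ker (X * Y) ~> Z) (g : Z -> \bar R) x :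
  (forall z, 0 <= g z) -> measurable_fun setT g ->
  measurable_fun setT (fun y => \int[k (x, y)]_z g z).
Proof.
move=> g0 mg.
apply: (measurableT_comp (f := fun v => \int[k v]_z g z) (g := pair x)).
  by apply: measurable_fun_integral_kernel => // U mU; exact: measurable_kernel.
exact: pair1_measurable.
Qed.

(** * Iterated integrals along trajectories *)

Section iterated_integral.
Variables (R : realType) (dS dA : nat) (M : soc R dS dA) (pi : policy R dS dA).
Local Notation aug := (aug_state R dS).
Local Notation stg := (stage R dS dA).
Local Notation traj_kernel := (traj_kernel M pi).

Definition step_integral k n (g : n.+2.-tuple stg -> \bar R) (w : n.+1.-tuple stg) :=
  \int[noise_law M k]_xi
    let y := next_state (t := k) (tnth w ord_max, xi) in
    \int[pi k.+1 y]_(a in control M k.+1) g [tuple of rcons w (y, a)].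

(** Stages are integrated out from the last one back. As this makes sense for arbitrary [g], it can
    be rearranged without measurability conditions. *)
Fixpoint iter_integral t n : (n.+1.-tuple stg -> \bar R) -> aug -> \bar R :=
  match n with
  | 0 => fun g y => \int[pi t y]_(a in control M t) g [tuple (y, a)]
  | n'.+1 => fun g => @iter_integral t n' (step_integral (t + n') g)
  end.

(** Prepending a stage leaves the last stage alone, so it commutes with integrating out the end. *)
Lemma step_integral_cons k n (g : n.+3.-tuple stg -> \bar R) z (w : n.+1.-tuple stg) :
  step_integral k g [tuple of z :: w] =
  step_integral k (fun w' : n.+2.-tuple stg => g [tuple of z :: w']) w.
Proof.
apply: eq_integral => xi _ /=.
have -> : tnth [tuple of z :: w] ord_max = tnth w ord_max.
  by rewrite !(tnth_nth z).
apply: eq_integral => a _; congr g; exact: val_inj.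
Qed.

Lemma iter_integral_rcons t n (g : n.+2.-tuple stg -> \bar R) y :
  iter_integral t g y = iter_integral t (step_integral (t + n) g) y.
Proof. by []. Qed.

(* The iterated integral grows at the end of the trajectory, the dynamic
   programming equation splits off its beginning. *)
Lemma iter_integralS t n (g : n.+2.-tuple stg -> \bar R) y :
  iter_integral t g y =
  \int[pi t y]_(a in control M t) \int[noise_law M t]_xi
    iter_integral t.+1 (fun w : n.+1.-tuple stg => g [tuple of (y, a) :: w])
      (next_state ((y, a), xi)).
Proof.
elim: n g => [|n IH] g.
  rewrite /= addn0; apply: eq_integral => a _; apply: eq_integral => xi _ /=.
  have -> : tnth [tuple (y, a)] ord_max = (y, a) by [].
  by apply: eq_integral => b _; congr g; exact: val_inj.
rewrite iter_integral_rcons IH.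
apply: eq_integral => a _; apply: eq_integral => xi _.
rewrite iter_integral_rcons addSnnS.
have -> : (fun w : n.+1.-tuple stg => step_integral (t + n.+1) g [tuple of (y, a) :: w]) =
    step_integral (t + n.+1) (fun w : n.+2.-tuple stg => g [tuple of (y, a) :: w]).
  by apply/funext => w; exact: step_integral_cons.
by [].
Qed.

(** [admissible] constrains each stage separately; here consecutive stages are also linked by the
    dynamics for some noise. The recursion runs from the front, as in [iter_integralS]. *)
Fixpoint feasible t (y : aug) (s : seq stg) : Prop :=
  if s is z :: s' then
    [/\ z.1 = y, admissible_pairs M t z
      & s' = [::] \/ exists xi, feasible t.+1 (next_state (M := M) (t := t) (z, xi)) s']
  else True.

(** The iterated integral visits only feasible trajectories; splitting off the first stage matches
    the recursion of [feasible]. *)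
Lemma eq_iter_integral t n y (g1 g2 : n.+1.-tuple stg -> \bar R) :
  (t + n <= horizon M)%N -> aug_states M t y ->
  (forall w : n.+1.-tuple stg, feasible t y w -> g1 w = g2 w) ->
  iter_integral t g1 y = iter_integral t g2 y.
Proof.
elim: n t y g1 g2 => [|n IH] t y g1 g2 tn ty g12.
  apply: eq_integral => a; rewrite inE => ta; apply: g12.
  by split; [|split|left].
rewrite !iter_integralS; apply: eq_integral => a; rewrite inE => ta.
have tT : (t < horizon M)%N by rewrite (leq_trans _ tn)// addnS ltnS leq_addr.
have tya : admissible_pairs M t (y, a) by [].
apply: eq_integral => xi _; apply: IH.
- by rewrite addSnnS.
- exact: next_state_states.
- by move=> w wf; apply: g12; split=> //; right; exists xi.
Qed.

Lemma admissible_cons t n z (w : n.+1.-tuple stg) : admissible_pairs M t z ->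
  admissible M t.+1 w -> admissible M t [tuple of z :: w].
Proof.
move=> [tz1 tz2] aw i; have [->|i0] := eqVneq i ord0.
  by rewrite tnth0 addn0.
have [j ->] : exists j, i = lift ord0 j.
  by case: (unliftP ord0 i) i0 => [j ->|->]; [exists j|rewrite eqxx].
by rewrite tnthS /= /bump/= add1n -addSnnS; exact: aw.
Qed.

Lemma feasible_admissible t n y (w : n.+1.-tuple stg) :
  feasible t y w -> admissible M t w.
Proof.
elim: n t y w => [|n IH] t y w.
  case/tupleP: w => z w; rewrite (tuple0 w) => -[_ [tz1 tz2] _] i.
  by rewrite ord1 tnth0 addn0.
case/tupleP: w => z w [_ tz /= [w0|[xi fw]]].
  (* A tuple of length [n.+1] is not empty. *)
  by case/eqP/eqnP: (etrans (esym (size_tuple w)) (congr1 size w0)).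
by apply: admissible_cons => //; exact: IH fw.
Qed.

Lemma admissible_measurable t n : (t + n <= horizon M)%N ->
  measurable (@admissible _ _ _ M t n).
Proof.
move=> tn; rewrite (_ : @admissible _ _ _ M t n =
    \bigcap_(i in [set: 'I_n.+1]) ((@tnth _ stg ^~ i) @^-1` admissible_pairs M (t + i))).
  apply: fin_bigcap_measurable => // i _.
  rewrite -[X in measurable X]setTI; apply: measurable_tnth => //.
  apply: admissible_pairs_measurable; rewrite (leq_trans _ tn)// leq_add2l -ltnS.
  exact: ltn_ord.
by apply/seteqP; split=> w aw i; [move=> _; exact: aw|exact: aw].
Qed.

(** The mass is the integral of the constant one, and every layer is a probability. *)
Lemma step_kernel_setT k n v : step_kernel M pi k n v setT = 1.
Proof.
rewrite -[LHS]mul1e -(integral_cst (step_kernel M pi k n v) measurableT).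
rewrite integral_step_kernel//.
under eq_integral do rewrite integral_cst// mul1e prob_kernel.
by rewrite integral_cst// mul1e; exact: probability_setT.
Qed.

Lemma integral_traj_kernel0 t y (g : 1.-tuple stg -> \bar R) :
  (forall w, 0 <= g w) -> measurable_fun setT g ->
  \int[traj_kernel t 0 y]_w g w = \int[pi t y]_a g [tuple (y, a)].
Proof.
move=> g0 mg; rewrite integral_kcomp//.
by apply: eq_integral => a _; rewrite /kdirac integral_dirac// diracT mul1e.
Qed.

Lemma integral_traj_kernelS t n y (g : n.+2.-tuple stg -> \bar R) :
  (forall w, 0 <= g w) -> measurable_fun setT g ->
  \int[traj_kernel t n.+1 y]_w g w =
  \int[traj_kernel t n y]_w \int[step_kernel M pi (t + n) n (y, w)]_w' g w'.
Proof. by move=> g0 mg; rewrite integral_kcomp. Qed.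

Lemma traj_kernel_setT t n y : traj_kernel t n y setT = 1.
Proof.
rewrite -[LHS]mul1e -(integral_cst (traj_kernel t n y) measurableT).
elim: n => [|n IH].
  by rewrite integral_traj_kernel0// integral_cst// mul1e prob_kernel.
rewrite integral_traj_kernelS//.
by under eq_integral do rewrite integral_cst// mul1e step_kernel_setT.
Qed.

Hypothesis pi_MR : Pi_MR M pi.

End iterated_integral.

(** * Identification of the trajectory law with the kernel *)

Section trajectory_law.
Variables (R : realType) (dS dA : nat) (M : soc R dS dA) (pi : policy R dS dA).
Local Notation aug := (aug_state R dS).
Local Notation stg := (stage R dS dA).
Local Notation traj_kernel := (traj_kernel M pi).
Local Notation step_integral := (step_integral M pi).
Local Notation iter_integral := (iter_integral M pi).
Hypothesis pi_MR : Pi_MR M pi.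

Lemma integral_policy_control k y (h : borel 'rV[R]_dA -> \bar R) :
  (k <= horizon M)%N -> aug_states M k y ->
  (forall a, 0 <= h a) -> measurable_fun setT h ->
  \int[pi k y]_a h a = \int[pi k y]_(a in control M k) h a.
Proof.
move=> kT ky; apply: full_measure_integral.
- exact: control_measurable.
- exact: prob_kernel.
- exact: pi_MR.
Qed.

Lemma integral_step_admissible k n y (w : n.+1.-tuple stg)
    (g : n.+2.-tuple stg -> \bar R) :
  (k < horizon M)%N -> admissible_pairs M k (tnth w ord_max) ->
  (forall w', 0 <= g w') -> measurable_fun setT g ->
  \int[step_kernel M pi k n (y, w)]_w' g w' = step_integral k g w.
Proof.
move=> kT kw g0 mg; rewrite (integral_step_kernel M pi k _ g0 mg).
apply: eq_integral => xi _; apply: integral_policy_control.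
- exact: kT.
- exact: next_state_states.
- by move=> a; exact: g0.
- apply: (measurableT_comp mg).
  apply: (measurableT_comp (@extend_measurable _ _ _ _ _ _)).
  exact: pair1_measurable.
Qed.

(** Induction peels off the last stage. The kernel step matches [step_integral] after an admissible
    last stage, which suffices because the iterated integral sees feasible trajectories only. *)
Lemma integral_traj_kernel t n y (g : n.+1.-tuple stg -> \bar R) :
  (t + n <= horizon M)%N -> aug_states M t y ->
  (forall w, 0 <= g w) -> measurable_fun setT g ->
  \int[traj_kernel t n y]_w g w = iter_integral t g y.
Proof.
move=> tn ty; elim: n g tn => [|n IH] g tn g0 mg.
  rewrite addn0 in tn.
  rewrite (integral_traj_kernel0 M pi t _ g0 mg); apply: integral_policy_control => //.
  apply: (measurableT_comp mg).
  apply: (measurableT_comp (@init_tuple_measurable _ _ _)).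
  exact: pair1_measurable.
have tn' : (t + n < horizon M)%N by rewrite -addnS.
rewrite (integral_traj_kernelS M pi t _ g0 mg) (IH _ (ltnW tn')); first last.
- exact: measurable_fun_integral_section.
- by move=> w; apply: integral_ge0 => w' _; exact: g0.
rewrite iter_integral_rcons; apply: (eq_iter_integral pi (ltnW tn') ty).
move=> w /feasible_admissible/(_ ord_max) wmax.
exact: integral_step_admissible.
Qed.

(** In the iterated integral the indicator of the admissible set can be replaced by one, because
    feasible trajectories are admissible; what remains is the total mass. *)
Lemma traj_kernel_admissible t n y :
  (t + n <= horizon M)%N -> aug_states M t y ->
  traj_kernel t n y (@admissible _ _ _ M t n) = 1.
Proof.
move=> tn ty; have mA := admissible_measurable tn.
rewrite -(setIT (@admissible _ _ _ M t n)) -(integral_indic _ measurableT mA).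
rewrite (integral_traj_kernel tn ty); first last.
- exact/measurable_EFinP.
- by move=> w; rewrite lee_fin.
rewrite (eq_iter_integral (g2 := cst 1) pi tn ty); last first.
  by move=> w /feasible_admissible aw; rewrite indicE mem_set.
rewrite -(integral_traj_kernel tn ty)//.
by rewrite (integral_cst _ measurableT) mul1e; exact: traj_kernel_setT.
Qed.

Lemma traj_kernel0E t y B : measurable B ->
  traj_kernel t 0 y B = pi t y [set a | B [tuple (y, a)]].
Proof.
move=> mB; rewrite -[in LHS](setIT B) -(integral_indic _ measurableT mB).
rewrite integral_traj_kernel0; [|by move=> w; rewrite lee_fin|exact/measurable_EFinP].
rewrite -[X in pi t y X]setIT -(integral_indic _ measurableT)//.
rewrite -[X in measurable X]setTI.
apply: (measurableT_comp (@init_tuple_measurable _ _ _) (@pair1_measurable _ _ _ _ y)) => //.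
Qed.

Lemma step_kernelE k n y (w : n.+1.-tuple stg) B : measurable B ->
  (k < horizon M)%N -> admissible_pairs M k (tnth w ord_max) ->
  step_kernel M pi k n (y, w) B =
  \int[noise_law M k]_xi
    let last_stage := tnth w ord_max in
    let y' := aug_transition last_stage.1 last_stage.2 xi in
    pi k.+1 y' [set a | B [tuple of rcons w (y', a)]].
Proof.
move=> mB kT kw; rewrite -[in LHS](setIT B) -(integral_indic _ measurableT mB).
rewrite integral_step_kernel; [|by move=> w'; rewrite lee_fin|exact/measurable_EFinP].
apply: eq_integral => xi _ /=.
rewrite -(next_stateE xi kT kw).
rewrite (_ : [set a | _] = (fun a => extend (y, w, xi, a)) @^-1` B)//.
rewrite -[X in pi _ _ X]setIT -(integral_indic _ measurableT)//.
rewrite -[X in measurable X]setTI.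
apply: (measurableT_comp (@extend_measurable _ _ _ _ _ _)) => //.
Qed.

Lemma traj_law_rcons t n y (B : set (n.+2.-tuple stg)) :
  traj_law M pi t y B =
  \int[traj_law M pi t y (n := n)]_(w in @admissible _ _ _ M t n)
    \int[noise_law M (t + n)]_xi
      let last_stage := tnth w ord_max in
      let y' := aug_transition last_stage.1 last_stage.2 xi in
      pi (t + n).+1 y' [set a | B [tuple of rcons w (y', a)]].
Proof. by []. Qed.

(** Each step of [traj_law] integrates over [admissible], which loses nothing as that set has full
    mass; the induction hypothesis on measurable sets then replaces the set function in the outer
    integral. *)
Lemma traj_lawE t n y (B : set (n.+1.-tuple stg)) :
  (t + n <= horizon M)%N -> aug_states M t y -> measurable B ->
  traj_law M pi t y B = traj_kernel t n y B.
Proof.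
elim: n B => [|n IH] B tn ty mB; first by rewrite traj_kernel0E.
have tn' : (t + n < horizon M)%N by rewrite -addnS.
have mA := admissible_measurable (ltnW tn').
rewrite -[in RHS](setIT B) -(integral_indic _ measurableT mB).
rewrite integral_traj_kernelS; [|by move=> w; rewrite lee_fin|exact/measurable_EFinP].
rewrite (full_measure_integral mA); first last.
- by apply: measurable_fun_integral_section => [w|]; [rewrite lee_fin|exact/measurable_EFinP].
- by move=> w; apply: integral_ge0 => w' _; rewrite lee_fin.
- by apply: traj_kernel_admissible => //; exact: ltnW.
- exact: traj_kernel_setT.
rewrite traj_law_rcons (eq_integral_set_function _ _ (fun C mC => IH C (ltnW tn') ty mC)).
apply: eq_integral => w; rewrite inE => /(_ ord_max) wmax.
by rewrite (integral_indic _ measurableT mB) setIT step_kernelE.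
Qed.

End trajectory_law.

(** Meant for [m1 = pi t y], a kernel value typed as a mere measure. A measure of mass one equals
    its normalization, a probability, to which Tonelli's theorem applies. *)
Lemma fubini_tonelli_mass1 d1 d2 (T1 : measurableType d1) (T2 : measurableType d2)
    (R : realType) (m1 : {measure set T1 -> \bar R}) (m2 : probability T2 R)
    (f : T1 * T2 -> \bar R) :
  m1 setT = 1 -> (forall z, 0 <= f z) -> measurable_fun setT f ->
  \int[m1 \x m2]_z f z = \int[m1]_x \int[m2]_y f (x, y).
Proof.
move=> m1T f0 mf.
(* The Dirac mass is the default for mass zero or infinity, excluded by [m1T]. *)
pose P : probability T1 R := mnormalize m1 (dirac point).
have -> : m1 = P :> {measure set T1 -> \bar R}.
  apply: eq_measure; apply/funext => A; rewrite /P /= /mnormalize m1T.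
  by rewrite onee_eq0/= invr1 mule1.
exact: fubini_tonelli1.
Qed.

(** * Value functions and the dynamic programming equation *)

Section value_recursion.
Variables (R : realType) (dS dA dTheta : nat) (M : soc R dS dA).
Variables (Theta : set 'rV[R]_dTheta) (f : 'rV[R]_dTheta -> R -> R).
Variables (L_C L_Theta R_Theta : R).
Hypothesis Hf : standing_assumption M Theta f L_C L_Theta R_Theta.
Variable pi : policy R dS dA.
Hypothesis pi_MR : Pi_MR M pi.
Local Notation aug := (aug_state R dS).
Local Notation stg := (stage R dS dA).
Local Notation adm t n := (@admissible _ _ _ M t n).

(** The integral of [expect] with a free length [n], so that arguments based on [t + n = horizon M]
    avoid subtraction in types. *)
Definition traj_mean t n y (g : n.+1.-tuple stg -> R) : \bar R :=
  \int[traj_law M pi t y (n:=n)]_(w in adm t n) (g w)%:E.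

Lemma traj_mean_kernel t n y (g : n.+1.-tuple stg -> R) :
  (t + n <= horizon M)%N -> aug_states M t y ->
  traj_mean t y g = \int[traj_kernel M pi t n y]_(w in adm t n) (g w)%:E.
Proof.
by move=> tn ty; apply: eq_integral_set_function => A mA; exact: traj_lawE.
Qed.

Lemma traj_mean_addc t n y (g : n.+1.-tuple stg -> R) (K c : R) :
  (t + n <= horizon M)%N -> aug_states M t y ->
  measurable_fun (adm t n) g -> (forall w, adm t n w -> (`|g w| <= K)%R) ->
  traj_mean t y (fun w => g w + c)%R = traj_mean t y g + c%:E.
Proof.
move=> tn ty mg gK; rewrite !traj_mean_kernel// (integral_bounded_addc (K := K))//.
- exact: admissible_measurable.
- exact: traj_kernel_admissible.
Qed.

(* The shift by [K] makes the integrand nonnegative, so that Tonelli's theorem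
   applies to the iterated integral. *)
Lemma traj_mean_iter t n y (g : n.+1.-tuple stg -> R) (K : R) (h : n.+1.-tuple stg -> \bar R) :
  (t + n <= horizon M)%N -> aug_states M t y ->
  measurable_fun (adm t n) g -> (forall w, adm t n w -> (`|g w| <= K)%R) ->
  (forall w, 0 <= h w) -> measurable_fun setT h ->
  (forall w, adm t n w -> h w = (g w + K)%:E) ->
  traj_mean t y g + K%:E = iter_integral M pi t h y.
Proof.
move=> tn ty mg gK h0 mh hg.
rewrite -(traj_mean_addc (K := K))// traj_mean_kernel//.
rewrite -integral_traj_kernel// (@full_measure_integral _ _ _ _ (adm t n))//.
- by apply: eq_integral => w; rewrite inE => /hg ->.
- exact: admissible_measurable.
- exact: traj_kernel_setT.
- exact: traj_kernel_admissible.
Qed.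

(** Shifted by a common bound, both means become iterated integrals, which depend only on feasible
    trajectories; the shift then cancels. *)
Lemma eq_traj_mean t n y (g1 g2 : n.+1.-tuple stg -> R) (K1 K2 : R) :
  (t + n <= horizon M)%N -> aug_states M t y ->
  measurable_fun (adm t n) g1 -> measurable_fun (adm t n) g2 ->
  (forall w, adm t n w -> (`|g1 w| <= K1)%R) ->
  (forall w, adm t n w -> (`|g2 w| <= K2)%R) ->
  (forall w : n.+1.-tuple stg, feasible M t y w -> g1 w = g2 w) ->
  traj_mean t y g1 = traj_mean t y g2.
Proof.
move=> tn ty mg1 mg2 gK1 gK2 g12; pose K := Num.max K1 K2.
have mA := admissible_measurable tn.
have {}gK1 w : adm t n w -> (`|g1 w| <= K)%R.
  by move=> /gK1 /le_trans; apply; rewrite le_max lexx.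
have {}gK2 w : adm t n w -> (`|g2 w| <= K)%R.
  by move=> /gK2 /le_trans; apply; rewrite le_max lexx orbT.
have shift (g : n.+1.-tuple stg -> R) : measurable_fun (adm t n) g ->
    (forall w, adm t n w -> (`|g w| <= K)%R) ->
    traj_mean t y g + K%:E =
    iter_integral M pi t ((fun w => (g w + K)%:E) \_ (adm t n)) y.
  move=> mg gK; apply: traj_mean_iter => //.
  - move=> w; rewrite patchE; case: ifPn => // /set_mem /gK.
    by rewrite ler_norml lee_fin -lerBlDr sub0r => /andP[].
  - apply/(measurable_restrictT _ _).1 => //; apply/measurable_EFinP.
    exact: measurable_funD.
  - by move=> w wA; rewrite patchE mem_set.
have : traj_mean t y g1 + K%:E = traj_mean t y g2 + K%:E.
  rewrite !shift//; apply: eq_iter_integral => // w fw.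
  by rewrite !patchE g12.
by move/(congr1 (fun x => x - K%:E)); rewrite !addeK.
Qed.

Section fixed_parameter.
Variable theta : 'rV[R]_dTheta.
Hypothesis Theta_theta : Theta theta.

(** The absolute value provides a nonnegative constant whatever the sign of [L_C]. *)
Let L : R := `|L_C|%R.

Lemma f_measurable : measurable_fun (`[0%R, (horizon M).+1%:R] : set R) (f theta).
Proof.
case: Hf => lipC _ _; apply: measurable_fun_lipschitz_itv.
by move=> x y; exact: lipC.
Qed.

(** Places both arguments of [f theta] in [[0, T + 1]], where the Lipschitz bound holds:
    [x <= t <= T] and the cost is at most one. *)
Lemma acc_cost_itv t z : (t <= horizon M)%N -> admissible_pairs M t z ->
  [/\ (0 <= z.1.2 <= (horizon M).+1%:R)%R,
      (0 <= z.1.2 + cost M t z.1.1 z.2 <= (horizon M).+1%:R)%R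
    & (0 <= cost M t z.1.1 z.2 <= 1)%R].
Proof.
move=> tT [[/= sz /andP[x0 xt]] az].
have /andP[c0 c1] := cost_bounded tT sz az.
have tT' : (t%:R + 1 <= (horizon M).+1%:R :> R)%R by rewrite natr1 ler_nat.
rewrite c0 c1 x0 addr_ge0//=; split=> //.
  by rewrite (le_trans xt)// (le_trans _ tT')// lerDl.
by rewrite (le_trans _ tT')// lerD.
Qed.

Lemma aug_cost_measurable t : (t <= horizon M)%N ->
  measurable_fun (admissible_pairs M t) (fun z => aug_cost M f theta t z.1 z.2).
Proof.
move=> tT; have mx : measurable_fun (admissible_pairs M t) (fun z : stg => z.1.2).
  by apply: measurable_funTS; do 2 apply: measurableT_comp => //.
apply: measurable_funB; apply: (measurable_comp (F := `[(0%R : R), (horizon M).+1%:R])) => //.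
- by move=> _ [z /(acc_cost_itv tT)[? ? ?] <-]; rewrite /= in_itv.
- exact: f_measurable.
- by apply: measurable_funD => //; exact: cost_measurable.
- by move=> _ [z /(acc_cost_itv tT)[? ? ?] <-]; rewrite /= in_itv.
- exact: f_measurable.
Qed.

Lemma aug_cost_bounded t z : (t <= horizon M)%N -> admissible_pairs M t z ->
  (`|aug_cost M f theta t z.1 z.2| <= L)%R.
Proof.
move=> tT tz; have [x01 xc01 /andP[c0 c1]] := acc_cost_itv tT tz.
case: Hf => lipC _ _; rewrite (le_trans (lipC _ _ _ Theta_theta xc01 x01))//.
rewrite addrAC subrr add0r ger0_norm// (le_trans (ler_wpM2r c0 (ler_norm L_C)))//.
by rewrite ler_piMr.
Qed.

Definition reward t n (w : n.+1.-tuple stg) : R :=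
  (\sum_(i < n.+1) aug_cost M f theta (t + i) (tnth w i).1 (tnth w i).2)%R.

(** Since the augmented cost is at least [- L], this is nonnegative; off the admissible pairs it is
    [0], so it is bounded and measurable on the whole space. *)
Definition shifted_cost t : stg -> R :=
  (fun z => aug_cost M f theta t z.1 z.2 + L)%R \_ (admissible_pairs M t).

Definition shifted_reward t n (w : n.+1.-tuple stg) : R :=
  (\sum_(i < n.+1) shifted_cost (t + i) (tnth w i))%R.

Lemma leq_index t n (i : 'I_n.+1) : (t + n <= horizon M)%N -> (t + i <= horizon M)%N.
Proof.
by move=> tn; rewrite (leq_trans _ tn)// leq_add2l -ltnS ltn_ord.
Qed.

Lemma measurable_tnth_comp t n (i : 'I_n.+1) (h : stg -> R) :
  (t + n <= horizon M)%N -> measurable_fun (admissible_pairs M (t + i)) h ->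
  measurable_fun (adm t n) (fun w => h (tnth w i)).
Proof.
move=> tn mh; apply: (measurable_comp _ _ mh) => //.
- by apply: admissible_pairs_measurable; exact: leq_index.
- by move=> _ [w aw <-]; exact: aw.
- by apply: measurable_funTS; exact: measurable_tnth.
Qed.

Lemma reward_measurable t n : (t + n <= horizon M)%N ->
  measurable_fun (adm t n) (@reward t n).
Proof.
move=> tn; apply: measurable_sum => i.
apply: (measurable_tnth_comp (h := fun z => aug_cost M f theta (t + i) z.1 z.2)) => //.
by apply: aug_cost_measurable; exact: leq_index.
Qed.

Lemma reward_bounded t n w : (t + n <= horizon M)%N -> adm t n w ->
  (`|reward t w| <= n.+1%:R * L)%R.
Proof.
move=> tn aw; rewrite (le_trans (ler_norm_sum _ _ _))//.
rewrite mulr_natl -[leRHS](_ : \sum_(i < n.+1) L = _)%R; last first.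
  by rewrite sumr_const card_ord.
apply: ler_sum => i _; apply: aug_cost_bounded; first exact: leq_index.
exact: aw.
Qed.

Lemma shifted_costE t z : admissible_pairs M t z ->
  shifted_cost t z = (aug_cost M f theta t z.1 z.2 + L)%R.
Proof. by move=> tz; rewrite /shifted_cost patchE mem_set. Qed.

Lemma shifted_cost_measurable t : (t <= horizon M)%N ->
  measurable_fun setT (shifted_cost t).
Proof.
move=> tT; apply/(measurable_restrictT _ _).1; first exact: admissible_pairs_measurable.
by apply: measurable_funD => //; exact: aug_cost_measurable.
Qed.

Lemma shifted_cost_bounded t z : (t <= horizon M)%N ->
  (0 <= shifted_cost t z <= L *+ 2)%R.
Proof.
move=> tT; rewrite /shifted_cost patchE; case: ifPn => [/set_mem tz|_].
  have := aug_cost_bounded tT tz; rewrite ler_norml => /andP[? ?].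
  by rewrite -lerBlDr sub0r mulr2n lerD2r; apply/andP.
by rewrite lexx mulrn_wge0 /L /=.
Qed.

Lemma shifted_reward_measurable t n : (t + n <= horizon M)%N ->
  measurable_fun setT (@shifted_reward t n).
Proof.
move=> tn; apply: measurable_sum => i.
apply: (measurableT_comp (shifted_cost_measurable _)); last exact: measurable_tnth.
exact: leq_index.
Qed.

Lemma shifted_reward_bounded t n w : (t + n <= horizon M)%N ->
  (0 <= @shifted_reward t n w <= n.+1%:R * (L *+ 2))%R.
Proof.
move=> tn; have b i := shifted_cost_bounded (tnth w i) (leq_index i tn).
rewrite sumr_ge0 /=; last by move=> i _; case/andP: (b i).
rewrite mulr_natl -[leRHS](_ : \sum_(i < n.+1) L *+ 2 = _)%R; last first.
  by rewrite sumr_const card_ord.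
by apply: ler_sum => i _; case/andP: (b i).
Qed.

Lemma shifted_rewardE t n w : adm t n w ->
  shifted_reward t w = (reward t w + n.+1%:R * L)%R.
Proof.
move=> aw; rewrite mulr_natl -[X in (_ + X)%R](_ : \sum_(i < n.+1) L = _)%R; last first.
  by rewrite sumr_const card_ord.
by rewrite -big_split; apply: eq_bigr => i _; rewrite shifted_costE//; exact: aw.
Qed.

Lemma valueE t n y : (t + n)%N = horizon M ->
  value M f pi theta t y = traj_mean t y (@reward t n).
Proof.
move=> tn; have -> : n = (horizon M - t)%N by rewrite -tn addKn.
by [].
Qed.

Lemma value_iter t n y : (t + n)%N = horizon M -> aug_states M t y ->
  value M f pi theta t y + (n.+1%:R * L)%:E =
  iter_integral M pi t (fun w : n.+1.-tuple stg => (shifted_reward t w)%:E) y.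
Proof.
move=> tn ty; have tn' : (t + n <= horizon M)%N by rewrite tn.
rewrite (valueE _ tn); apply: traj_mean_iter => //.
- exact: reward_measurable.
- by move=> w; exact: reward_bounded.
- by move=> w; rewrite lee_fin; case/andP: (shifted_reward_bounded w tn').
- by apply/measurable_EFinP; exact: shifted_reward_measurable.
- by move=> w aw; rewrite shifted_rewardE.
Qed.

(** With a single stage left, the iterated integral is one integral over the action. The equation is
    proved with both sides shifted by [L]. *)
Lemma value_horizon y : aug_states M (horizon M) y ->
  value M f pi theta (horizon M) y =
  \int[pi (horizon M) y]_(a in control M (horizon M))
    (aug_cost M f theta (horizon M) y a)%:E.
Proof.
set T := horizon M => Ty.
have mc := @control_measurable _ _ _ M T (leqnn _).
have : value M f pi theta T y + L%:E =
    \int[pi T y]_(a in control M T) (aug_cost M f theta T y a)%:E + L%:E.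
  rewrite -[X in _ + X%:E]mul1r (@value_iter T 0)//; last by rewrite addn0.
  rewrite -(integral_bounded_addc (K := L))//=.
  - apply: eq_integral => a; rewrite inE => Ta.
    by rewrite /shifted_reward big_ord1 addn0 tnth0 shifted_costE.
  - exact: pi_MR.
  - apply: (measurable_comp (F := admissible_pairs M T)
      (f := fun z => aug_cost M f theta T z.1 z.2) (g := pair y)) => //.
    + exact: admissible_pairs_measurable.
    + by move=> _ [a Ta <-].
    + exact: aug_cost_measurable.
    + by apply: measurable_funTS; exact: pair1_measurable.
  - by move=> a Ta; apply: (@aug_cost_bounded T (y, a)).
by move/(congr1 (fun x => x - L%:E)); rewrite !addeK.
Qed.

Lemma shifted_reward_cons t n z (w : n.+1.-tuple stg) :
  shifted_reward t [tuple of z :: w] = (shifted_cost t z + shifted_reward t.+1 w)%R.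
Proof.
rewrite /shifted_reward big_ord_recl addn0 tnth0; congr (_ + _)%R.
by apply: eq_bigr => i _; rewrite tnthS lift0 addSnnS.
Qed.

Lemma iter_shifted_reward t n y :
  (t + n <= horizon M)%N -> aug_states M t y ->
  iter_integral M pi t (fun w : n.+1.-tuple stg => (shifted_reward t w)%:E) y =
  \int[traj_kernel M pi t n y]_w (shifted_reward t w)%:E.
Proof.
move=> tn ty; rewrite integral_traj_kernel//.
- by move=> w'; rewrite lee_fin; case/andP: (shifted_reward_bounded w' tn).
- by apply/measurable_EFinP; exact: shifted_reward_measurable.
Qed.

(** Defined through the kernel for every [y], hence measurable in [y], as needed to integrate it
    over the next state. On augmented states it is the value up to a constant. *)
Definition shifted_value t n y : R :=
  fine (\int[traj_kernel M pi t n y]_w (shifted_reward t w)%:E).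

Lemma integral_shifted_reward_bounded t n y : (t + n <= horizon M)%N ->
  0 <= \int[traj_kernel M pi t n y]_w (shifted_reward t w)%:E <=
    (n.+1%:R * (L *+ 2))%:E.
Proof.
move=> tn; have bnd := fun w => andP (@shifted_reward_bounded t n w tn).
apply/andP; split; first by apply: integral_ge0 => w _; rewrite lee_fin; case: (bnd w).
rewrite -[leRHS]mule1 -(traj_kernel_setT M pi t n y) -(integral_cst _ measurableT).
apply: ge0_le_integral; first exact: measurableT.
- by move=> w _; rewrite lee_fin; case: (bnd w).
- by apply/measurable_EFinP; exact: shifted_reward_measurable.
- exact: measurable_cst.
- by move=> w _; rewrite lee_fin; case: (bnd w).
Qed.

Lemma shifted_valueE t n y : (t + n <= horizon M)%N ->
  (shifted_value t n y)%:E = \int[traj_kernel M pi t n y]_w (shifted_reward t w)%:E.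
Proof.
move=> tn; have /andP[v0 vK] := integral_shifted_reward_bounded y tn.
by rewrite fineK// ge0_fin_numE// (le_lt_trans vK) ?ltry.
Qed.

Lemma shifted_value_bounded t n y : (t + n <= horizon M)%N ->
  (0 <= shifted_value t n y <= n.+1%:R * (L *+ 2))%R.
Proof.
by move=> tn; have := integral_shifted_reward_bounded y tn; rewrite -shifted_valueE// !lee_fin.
Qed.

Lemma shifted_value_measurable t n : (t + n <= horizon M)%N ->
  measurable_fun setT (shifted_value t n).
Proof.
move=> tn; apply: (measurableT_comp (@fine_measurable R setT measurableT)).
apply: measurable_fun_integral_kernel.
- by move=> U mU; exact: measurable_kernel.
- by move=> w; rewrite lee_fin; case/andP: (shifted_reward_bounded w tn).
- by apply/measurable_EFinP; exact: shifted_reward_measurable.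
Qed.

Lemma value_shifted_value t n y : (t + n)%N = horizon M -> aug_states M t y ->
  value M f pi theta t y = (shifted_value t n y - n.+1%:R * L)%:E.
Proof.
move=> tn ty; have tn' : (t + n <= horizon M)%N by rewrite tn.
have := value_iter tn ty; rewrite iter_shifted_reward// -shifted_valueE//.
by move/(congr1 (fun x => x - (n.+1%:R * L)%:E)); rewrite addeK// EFinB.
Qed.

(** Both sides are compared after a shift, where everything is nonnegative and Tonelli's theorem
    merges the integrals over action and noise into one over the product. *)
Lemma value_step t y : (t < horizon M)%N -> aug_states M t y ->
  value M f pi theta t y =
  \int[pi t y \x noise_law M t]_(z in control M t `*` setT)
    ((aug_cost M f theta t y z.1)%:E
     + value M f pi theta t.+1 (aug_transition y z.1 z.2)).
Proof.
move=> tT ty; have tT' := ltnW tT.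
pose n := (horizon M - t.+1)%N.
have tn : (t.+1 + n)%N = horizon M by rewrite subnKC.
have tn1 : (t + n.+1)%N = horizon M by rewrite -addSnnS.
have tn' : (t.+1 + n <= horizon M)%N by rewrite tn.
(* From [t] to the horizon there are [n.+2] stages, each shifted by [L]. *)
pose C : R := (n.+2%:R * L)%R.
(* The shifted integrand, made total by [next_state] and [shifted_cost]. *)
pose q (z : borel 'rV[R]_dA * borel (noise M t)) : R :=
  (shifted_value t.+1 n (next_state (t := t) ((y, z.1), z.2)) + shifted_cost t (y, z.1))%R.
have mq : measurable_fun setT q.
  apply: measurable_funD.
    apply: (measurableT_comp (shifted_value_measurable tn')).
    apply: (measurableT_comp (@next_state_measurable R dS dA M t)).
    apply: measurable_fun_pair; last exact: measurable_snd.
    by apply: (measurableT_comp (@pair1_measurable _ _ _ _ y)).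
  apply: (measurableT_comp (shifted_cost_measurable tT')).
  by apply: (measurableT_comp (@pair1_measurable _ _ _ _ y)).
have q0 z : (0 <= q z <= n.+1%:R * (L *+ 2) + L *+ 2)%R.
  have /andP[v0 vK] := shifted_value_bounded (next_state (t := t) ((y, z.1), z.2)) tn'.
  have /andP[c0 cK] := shifted_cost_bounded (y, z.1) tT'.
  by rewrite addr_ge0//= lerD.
have qE0 z : 0 <= (q z)%:E by rewrite lee_fin; case/andP: (q0 z).
have mqE : measurable_fun setT (EFin \o q) by exact/measurable_EFinP.
have mc := control_measurable tT'.
pose D : set (borel 'rV[R]_dA * borel (noise M t)) := control M t `*` setT.
have mD : measurable D by exact: measurableX.
have muc : (pi t y \x noise_law M t) D = 1.
  transitivity (pi t y (control M t) * noise_law M t setT).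
    exact: product_measure1E.
  by rewrite (pi_MR tT' ty) probability_setT mule1.
have muT : (pi t y \x noise_law M t) setT = 1.
  transitivity (pi t y setT * noise_law M t setT).
    by rewrite -setXTT; exact: product_measure1E.
  by rewrite prob_kernel probability_setT mule1.
have valueC : value M f pi theta t y + C%:E =
    \int[pi t y \x noise_law M t]_(z in D) (q z)%:E.
  rewrite (value_iter tn1 ty) iter_integralS.
  rewrite -(full_measure_integral (A := D) mD muT muc qE0 mqE).
  rewrite (fubini_tonelli_mass1 (m1 := pi t y) (noise_law M t)
    (@prob_kernel _ _ _ _ _ (pi t) y) qE0 mqE).
  rewrite (integral_policy_control pi_MR tT' ty); first last.
  - exact: (measurable_fun_fubini_tonelli_F (m2 := noise_law M t) _ mqE qE0).
  - by move=> a; apply: integral_ge0 => xi _; exact: qE0.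
  apply: eq_integral => a; rewrite inE => ta; apply: eq_integral => xi _.
  have tya : admissible_pairs M t (y, a) by [].
  have ty' := next_state_states xi tT tya.
  rewrite /q EFinD shifted_valueE//.
  (* The current cost is constant along the continuation and leaves the inner integral. *)
  have -> : (fun w : n.+1.-tuple stg => (shifted_reward t [tuple of (y, a) :: w])%:E) =
      (fun w => (shifted_reward t.+1 w + shifted_cost t (y, a))%:E).
    by apply/funext => w; rewrite shifted_reward_cons addrC.
  have mr := shifted_reward_measurable tn'.
  rewrite -(integral_traj_kernel pi_MR tn' ty'); first last.
  - apply/measurable_EFinP; apply: measurable_funD => //; exact: measurable_cst.
  - move=> w; rewrite lee_fin addr_ge0//.
      by case/andP: (shifted_reward_bounded w tn').
    by case/andP: (shifted_cost_bounded (y, a) tT').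
  apply: (integral_bounded_addc (K := (n.+1%:R * (L *+ 2))%R)) => //.
    exact: traj_kernel_setT.
  by move=> w _; have /andP[r0 rK] := shifted_reward_bounded w tn'; rewrite ger0_norm.
transitivity (\int[pi t y \x noise_law M t]_(z in D) (q z + - C)%:E).
  rewrite (integral_bounded_addc (K := (n.+1%:R * (L *+ 2) + L *+ 2)%R))//.
  - by move/(congr1 (fun x => x - C%:E)): valueC; rewrite addeK.
  - exact: measurable_funTS.
  - by move=> z _; have /andP[r0 rK] := q0 z; rewrite ger0_norm.
apply: eq_integral => z; rewrite inE => -[tz _].
have tyz : admissible_pairs M t (y, z.1) by [].
have ty' := aug_transition_states z.2 tT tyz.
rewrite (value_shifted_value tn ty') -EFinD /q (next_stateE _ tT tyz) shifted_costE//=.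
(* Of the shifts in [C], [n.+1] belong to the future value and one to the current cost. *)
congr EFin; rewrite /C -[n.+2%:R]natr1 mulrDl mul1r opprD addrACA addrK.
by rewrite addrC.
Qed.

(** * Telescoping costs and the risk *)

Definition total_cost t n (w : n.+1.-tuple stg) : R :=
  (\sum_(i < n.+1) cost M (t + i) (tnth w i).1.1 (tnth w i).2)%R.

Lemma reward_cons t n z (w : n.+1.-tuple stg) :
  reward t [tuple of z :: w] = (aug_cost M f theta t z.1 z.2 + reward t.+1 w)%R.
Proof.
rewrite /reward big_ord_recl addn0 tnth0; congr (_ + _)%R.
by apply: eq_bigr => i _; rewrite tnthS lift0 addSnnS.
Qed.

Lemma total_cost_cons t n z (w : n.+1.-tuple stg) :
  total_cost t [tuple of z :: w] = (cost M t z.1.1 z.2 + total_cost t.+1 w)%R.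
Proof.
rewrite /total_cost big_ord_recl addn0 tnth0; congr (_ + _)%R.
by apply: eq_bigr => i _; rewrite tnthS lift0 addSnnS.
Qed.

(** The sum telescopes: along a feasible trajectory the next accumulated cost is the current one
    plus the cost just paid, so the intermediate values of [f theta] cancel. *)
Lemma feasible_reward t n y (w : n.+1.-tuple stg) : (t + n <= horizon M)%N ->
  feasible M t y w ->
  reward t w = (f theta (y.2 + total_cost t w) - f theta y.2)%R.
Proof.
elim: n t y w => [|n IH] t y w tn.
  case/tupleP: w => z w; rewrite (tuple0 w) => -[<- _ _].
  by rewrite /reward /total_cost !big_ord1 tnth0 addn0.
case/tupleP: w => z w [<- tz /= [w0|[xi fw]]].
  by case/eqP/eqnP: (etrans (esym (size_tuple w)) (congr1 size w0)).
have tT : (t < horizon M)%N by rewrite (leq_trans _ tn)// addnS ltnS leq_addr.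
rewrite reward_cons total_cost_cons (IH _ _ _ _ fw) ?addSnnS// next_stateE//=.
by rewrite /aug_cost addrC subrKA addrA.
Qed.

Lemma total_cost_itv n w : (n <= horizon M)%N -> adm 0 n w ->
  (0 <= total_cost 0 w <= (horizon M).+1%:R)%R.
Proof.
move=> nT aw; have c01 (i : 'I_n.+1) : (0 <= cost M (0 + i) (tnth w i).1.1 (tnth w i).2 <= 1)%R.
  by have [] := acc_cost_itv (@leq_index 0 n i nT) (aw i).
rewrite sumr_ge0/=; last by move=> i _; case/andP: (c01 i).
rewrite (@le_trans _ _ (\sum_(i < n.+1) 1)%R)//.
  by apply: ler_sum => i _; case/andP: (c01 i).
by rewrite sumr_const card_ord ler_nat.
Qed.

Lemma total_cost_measurable t n : (t + n <= horizon M)%N ->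
  measurable_fun (adm t n) (@total_cost t n).
Proof.
move=> tn; apply: measurable_sum => i.
apply: (measurable_tnth_comp (h := fun z => cost M (t + i) z.1.1 z.2)) => //.
by apply: cost_measurable; exact: leq_index.
Qed.

(** Starting from accumulated cost [0], telescoping identifies the two integrands on feasible
    trajectories, and the constant [f theta 0] comes out of the mean. *)
Lemma traj_mean_total_cost n s : n = horizon M -> state M 0 s ->
  @traj_mean 0 n (s, 0%R) (fun w => f theta (total_cost 0 w)) =
  value M f pi theta 0 (s, 0%R) + (f theta 0%R)%:E.
Proof.
move=> nT Ms; have n0T : (0 + n <= horizon M)%N by rewrite nT.
have ty : aug_states M 0 (s, 0%R : R) by split=> //=; rewrite /acc/= lexx.
have mA := admissible_measurable n0T.
have itv0 : (0 <= (0 : R) <= (horizon M).+1%:R)%R by rewrite lexx ler0n.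
rewrite (@valueE 0 n)// -(traj_mean_addc (K := (n.+1%:R * L)%R))//.
(* [K1] is the Lipschitz bound from [0] over an interval of length [T + 1]; [K2] adds [|f theta 0|]
   to the bound on the reward. *)
- apply: (eq_traj_mean (K1 := (`|f theta 0| + L * (horizon M).+1%:R)%R)
    (K2 := (n.+1%:R * L + `|f theta 0|)%R)) => //.
  + apply: (measurable_comp (F := `[(0%R : R), (horizon M).+1%:R])) => //.
    * by move=> _ [w aw <-]; rewrite /= in_itv; apply: total_cost_itv => //; rewrite nT.
    * exact: f_measurable.
    * exact: total_cost_measurable.
  + by apply: measurable_funD => //; exact: reward_measurable.
  + move=> w aw; have cw := total_cost_itv n0T aw; case/andP: (cw) => c0 c1.
    rewrite -(subrK (f theta 0%R) (f theta _)) (le_trans (ler_normD _ _))// addrC lerD2l.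
    case: Hf => lipC _ _; rewrite (le_trans (lipC _ _ _ Theta_theta cw itv0))//.
    rewrite subr0 ger0_norm// (le_trans (ler_wpM2r c0 (ler_norm L_C)))//.
    by rewrite ler_wpM2l.
  + move=> w aw; rewrite (le_trans (ler_normD _ _))// lerD2r.
    exact: reward_bounded.
  + by move=> w fw; rewrite (feasible_reward n0T fw) add0r subrK.
- exact: reward_measurable.
- by move=> w; exact: reward_bounded.
Qed.

End fixed_parameter.
End value_recursion.

Local Close Scope ereal_scope.

Theorem theorem3p2 (R : realType) (dS dA dTheta : nat) (M : soc R dS dA)
    (Theta : set 'rV[R]_dTheta) (f : 'rV[R]_dTheta -> R -> R)
    (L_C L_Theta R_Theta : R)
    (Hf : standing_assumption M Theta f L_C L_Theta R_Theta) :
  (forall (theta : 'rV[R]_dTheta) (pi : policy R dS dA),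
    Theta theta -> Pi_MR M pi ->
    (forall y : aug_state R dS, aug_states M (horizon M) y ->
      value M f pi theta (horizon M) y =
      (\int[pi (horizon M) y]_(a in control M (horizon M))
         (aug_cost M f theta (horizon M) y a)%:E)%E)
    /\
    (forall (t : nat) (y : aug_state R dS),
      (t < horizon M)%N -> aug_states M t y ->
      value M f pi theta t y =
      (\int[pi t y \x noise_law M t]_(z in control M t `*` setT)
         ((aug_cost M f theta t y z.1)%:E
          + value M f pi theta t.+1 (aug_transition y z.1 z.2)))%E))
  /\
  (forall (pi : policy R dS dA) (s : 'rV[R]_dS) (theta_pi : 'rV[R]_dTheta),
    Pi_MR M pi -> state M 0 s ->
    argmin Theta
      (fun theta => (value M f pi theta 0 (s, 0%R) + (f theta 0%R)%:E)%E)
      theta_pi ->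
    risk M Theta f pi s =
    (value M f pi theta_pi 0 (s, 0%R) + (f theta_pi 0%R)%:E)%E).
Proof.
split=> [theta pi Ttheta pi_MR|pi s theta_pi pi_MR Ms [Ttheta_pi theta_min]].
  split=> [y|t y]; first exact: (value_horizon Hf pi_MR Ttheta).
  exact: (value_step Hf pi_MR Ttheta).
(* Rewrites each member of the family whose infimum is the risk; [subn0] accounts for the length
   [horizon M - 0]. *)
have riskE theta : Theta theta ->
    expect (M := M) pi (t := 0) (s, 0%R) (fun w => f theta (\sum_(i < (horizon M - 0).+1)
      cost M i (tnth w i).1.1 (tnth w i).2)) =
    (value M f pi theta 0 (s, 0%R) + (f theta 0%R)%:E)%E.
  by move=> Ttheta; exact: (traj_mean_total_cost Hf pi_MR Ttheta (subn0 _) Ms).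
(* Membership of [theta_pi] in [Theta] gives one inequality, its minimality the other. *)
apply/eqP; rewrite eq_le; apply/andP; split.
  by apply: ereal_inf_lbound; exists theta_pi => //; exact: riskE.
apply/ereal_infP => _ [theta Ttheta <-]; rewrite riskE//; exact: theta_min.
Qed.
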